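(* Let $\varepsilon_{\mathrm{out}}>0$, $\lambda_0\in\mathbb{R}^m$, $R_{\mathrm d}=\|\lambda_0-\lambda^*\|>0$, and put $$k_{\mathrm{out}}:=\left\lfloor 2R_{\mathrm d}\sqrt{\frac{L_{\mathrm d}}{\varepsilon_{\mathrm{out}}}}\right\rfloor,\qquad \varepsilon_{\mathrm{in}}:=\frac{3}{8\left(1+\sqrt{2L_{\mathrm p}}\,R_{\mathrm p}\right)(k_{\mathrm{out}}+3)}\,\varepsilon_{\mathrm{out}} .$$ Assume that for every $\lambda\in\mathbb{R}^m$ the point $\bar z(\lambda)\in Z$ satisfies $$\min_{z\in Z}\langle \nabla\mathcal{L}_\rho(\bar z(\lambda),\lambda),\, z-\bar z(\lambda)\rangle \ge -\left(1+\sqrt{2L_{\mathrm p}}\,R_{\mathrm p}\right)\varepsilon_{\mathrm{in}} .$$ Let $\theta_0=1$, $\theta_{k+1}=\frac12\left(1+\sqrt{4\theta_k^2+1}\right)$, $S_k=\sum_{j=0}^k\theta_j$, $a_{k+1}=S_{k+1}^{-1}\theta_{k+1}$, let $(\lambda_k)_{k\ge0}$, $(\mu_k)_{k\ge0}$ be generated by the inexact dual fast gradient method $$\mu_k=\lambda_k+L_{\mathrm d}^{-1}\nabla\bar d_\rho(\lambda_k),\qquad \lambda_{k+1}=(1-a_{k+1})\mu_k+a_{k+1}\Big[\lambda_0+L_{\mathrm d}^{-1}\sum_{i=0}^k\theta_i\nabla\bar d_\rho(\lambda_i)\Big],$$ and let $\hat z_k=S_k^{-1}\sum_{j=0}^k\theta_j\bar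 z(\lambda_j)$. Then $$f^*-d_\rho(\mu_{k_{\mathrm{out}}})\le\varepsilon_{\mathrm{out}},\qquad \hat z_{k_{\mathrm{out}}}\in Z,\qquad \|A\hat z_{k_{\mathrm{out}}}-b\|\le\frac{3}{R_{\mathrm d}}\varepsilon_{\mathrm{out}},$$ $$-\left(\frac{3\|\lambda^*\|}{R_{\mathrm d}}+\frac{9\rho}{2R_{\mathrm d}^2}\varepsilon_{\mathrm{out}}\right)\varepsilon_{\mathrm{out}}\le f(\hat z_{k_{\mathrm{out}}})-f^*\le\left(\frac{\|\lambda_0\|^2+R_{\mathrm d}^2}{2R_{\mathrm d}^2}\right)\varepsilon_{\mathrm{out}} .$$
   Context: Setting: $f:\mathbb{R}^n\to\mathbb{R}$ is convex and differentiable, $A\in\mathbb{R}^{m\times n}$ has full row rank, $b\in\mathbb{R}^m$, $Z\subset\mathbb{R}^n$ is nonempty, compact and convex, $\rho>0$; $\|\cdot\|$ and $\langle\cdot,\cdot\rangle$ are the Euclidean norm and inner product; $\lfloor\cdot\rfloor$ is the integer floor. Primal problem: $f^*=\min\{f(z): Az=b,\ z\in Z\}$. Augmented Lagrangian: $\mathcal{L}_\rho(z,\lambda)=f(z)+\langle\lambda,Az-b\rangle+\frac\rho2\|Az-b\|^2$; $\nabla\mathcal{L}_\rho$ denotes its gradient in $z$, assumed Lipschitz continuous in $z$ on $\mathbb{R}^n$ with constant $L_{\mathrm p}>0$ for each $\lambda$. $R_{\mathrm p}=\max_{z,y\in Z}\|z-y\|$. Augmented dual function: $d_\rho(\lambda)=\min_{z\in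 Z}\mathcal{L}_\rho(z,\lambda)$. Slater's constraint qualification is assumed, so that $f^*=\max_{\lambda}\min_{z\in Z}\{f(z)+\langle\lambda,Az-b\rangle\}$; $\lambda^*$ denotes a maximizer of this dual problem (the ordinary dual and the problem $\max_\lambda d_\rho(\lambda)$ have the same optimal value and the same optimal solutions). $L_{\mathrm d}=1/\rho$. Inexact dual information: for each $\lambda$ an approximate minimizer $\bar z(\lambda)\in Z$ of $\mathcal{L}_\rho(\cdot,\lambda)$ over $Z$ is fixed, and $\nabla\bar d_\rho(\lambda):=A\bar z(\lambda)-b$ (a notation, not necessarily a gradient). *)

(* Defs.v *)
From HB Require Import structures.
From mathcomp Require Import all_boot all_order all_algebra.
From mathcomp Require Import all_classical all_reals all_analysis.

Set Implicit Arguments.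
Unset Strict Implicit.
Unset Printing Implicit Defensive.

Import Order.TTheory GRing.Theory Num.Theory.
Import numFieldNormedType.Exports.

Local Open Scope classical_set_scope.
Local Open Scope ring_scope.

(* Least and greatest elements of a set of reals, required to belong to the
   set; the value 0 returned when there is none carries no meaning. *)
Definition set_min (R : realType) (E : set R) : R := xget 0 (E `&` lbound E).

Definition set_max (R : realType) (E : set R) : R := xget 0 (E `&` ubound E).

Definition inner (R : realType) (n : nat) (x y : 'cV[R]_n) : R :=
  \sum_(i < n) x i 0 * y i 0.

(* The library norm `|x| on 'cV[R]_n is the sup norm, which induces the same
   topology but is not the Euclidean norm. *)
Definition enorm (R : realType) (n : nat) (x : 'cV[R]_n) : R :=
  Num.sqrt (inner x x).

Definition grad (R : realType) (n : nat) (F : 'cV[R]_n -> R) (z : 'cV[R]_n) :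
    'cV[R]_n :=
  \col_i 'D_(delta_mx i 0) F z.

Definition affine_hull (R : realType) (n : nat) (Z : set 'cV[R]_n) :
    set 'cV[R]_n :=
  [set y | exists (k : nat) (c : 'I_k -> R) (x : 'I_k -> 'cV[R]_n),
    [/\ forall i, Z (x i), \sum_(i < k) c i = 1
      & y = \sum_(i < k) c i *: x i]].

Definition relint (R : realType) (n : nat) (Z : set 'cV[R]_n) :
    set 'cV[R]_n :=
  [set z | Z z /\ \forall y \near z, affine_hull Z y -> Z y].

Section Lagrangians.
Variables (R : realType) (m n : nat).
Variables (f : 'cV[R]_n -> R) (A : 'M[R]_(m, n)) (b : 'cV[R]_m).
Variable Z : set 'cV[R]_n.

Definition feasible : set 'cV[R]_n := [set z | A *m z = b /\ Z z].

Definition slater : Prop := exists2 z, relint Z z & A *m z = b.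

Definition primal_value : R := set_min [set f z | z in feasible].

Definition lagrange_dual (lambda : 'cV[R]_m) : R :=
  set_min [set f z + inner lambda (A *m z - b) | z in Z].

Definition aug_lagrangian (rho : R) (z : 'cV[R]_n) (lambda : 'cV[R]_m) : R :=
  f z + inner lambda (A *m z - b) + rho / 2 * enorm (A *m z - b) ^+ 2.

Definition grad_aug_lagrangian (rho : R) (z : 'cV[R]_n)
    (lambda : 'cV[R]_m) : 'cV[R]_n :=
  grad (fun y => aug_lagrangian rho y lambda) z.

Definition aug_dual (rho : R) (lambda : 'cV[R]_m) : R :=
  set_min [set aug_lagrangian rho z lambda | z in Z].

End Lagrangians.

Definition diam (R : realType) (n : nat) (Z : set 'cV[R]_n) : R :=
  set_max [set enorm (p.1 - p.2) | p in Z `*` Z].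

Fixpoint theta (R : realType) (k : nat) : R :=
  if k is k'.+1 then (1 + Num.sqrt (4 * theta R k' ^+ 2 + 1)) / 2 else 1.

Definition theta_sum (R : realType) (k : nat) : R := \sum_(j < k.+1) theta R j.

(* Main.v *)
Require Import Defs.
From HB Require Import structures.
From mathcomp Require Import all_boot all_order all_algebra.
From mathcomp Require Import all_classical all_reals all_analysis.
From mathcomp Require Import ring lra.

Set Implicit Arguments.
Unset Strict Implicit.
Unset Printing Implicit Defensive.

Import Order.TTheory GRing.Theory Num.Theory.
Import numFieldNormedType.Exports.

Local Open Scope classical_set_scope.
Local Open Scope ring_scope.

(* The augmented dual function [d] has an inexact first-order oracle with
   constant exactly [1 / rho].  If [z] is a [delta]-stationary point of
   [L_rho(., l)] and [g = A z - b], then [d <= L_rho(z, .)], which is affine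
   with slope [g].  Conversely, by convexity of [f], [z] minimises up to [delta]
   the Lagrangian with multiplier [l + rho g], and completing the square gives
   [d(x) >= L_rho(z, x) - delta - |x - l|^2 / (2 rho)].  Nesterov's estimate
   sequences and Jensen's inequality then yield, for all [x],
     L_rho(zhat_k, x)
       <= d(mu_k) + |x - lambda_0|^2 / (2 rho S_k) + (k + 1) delta,
   where [S_k = theta_k^2 >= (k + 2)^2 / 4].  The bounds follow by taking
   [x = lambda_star] (dual gap), [x = lambda_0 + rho S_k (A zhat_k - b)]
   (feasibility) and [x = 0] (upper bound on [f]).
   Strong duality comes from quadratic penalties: a minimiser of
   [f + c |A z - b|^2] over [Z] minimises the Lagrangian with multiplier
   [2 c (A z - b)], and by compactness its [f]-value is at least [f* - eps] for
   large [c]. *)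

Section InnerProduct.
Variables (R : realType) (n : nat).
Implicit Types (x y u : 'cV[R]_n) (t : R).

Lemma innerC x y : inner x y = inner y x.
Proof. by apply: eq_bigr => i _; rewrite mulrC. Qed.

Lemma innerDl x y u : inner (x + y) u = inner x u + inner y u.
Proof. by rewrite -big_split; apply: eq_bigr => i _; rewrite mxE mulrDl. Qed.

Lemma innerZl t x y : inner (t *: x) y = t * inner x y.
Proof.
by rewrite /inner mulr_sumr; apply: eq_bigr => i _; rewrite mxE mulrA.
Qed.

Lemma innerNl x y : inner (- x) y = - inner x y.
Proof. by rewrite -scaleN1r innerZl mulN1r. Qed.

Lemma innerBl x y u : inner (x - y) u = inner x u - inner y u.
Proof. by rewrite innerDl innerNl. Qed.

Lemma inner0l x : inner 0 x = 0.
Proof. by rewrite -(scale0r x) innerZl mul0r. Qed.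

Lemma innerDr x y u : inner u (x + y) = inner u x + inner u y.
Proof. by rewrite innerC innerDl !(innerC u). Qed.

Lemma innerZr t x y : inner x (t *: y) = t * inner x y.
Proof. by rewrite innerC innerZl innerC. Qed.

Lemma innerBr x y u : inner u (x - y) = inner u x - inner u y.
Proof. by rewrite innerC innerBl !(innerC u). Qed.

Lemma inner0r x : inner x 0 = 0.
Proof. by rewrite innerC inner0l. Qed.

Lemma inner_sumr (I : Type) (r : seq I) (F : I -> 'cV[R]_n) x :
  inner x (\sum_(i <- r) F i) = \sum_(i <- r) inner x (F i).
Proof. exact: (big_morph _ (fun y z => innerDr y z x) (inner0r x)). Qed.

Lemma enorm_ge0 x : 0 <= enorm x.
Proof. exact: sqrtr_ge0. Qed.

Lemma sqr_enorm x : enorm x ^+ 2 = inner x x.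
Proof. by rewrite sqr_sqrtr // sumr_ge0 // => i _; rewrite -expr2 sqr_ge0. Qed.

Lemma enorm0_eq0 x : enorm x = 0 -> x = 0.
Proof.
move=> x0; have : inner x x = 0 by rewrite -sqr_enorm x0 expr0n.
move=> /psumr_eq0P xx0; apply/matrixP => i j; rewrite ord1 mxE.
apply/eqP; rewrite -sqrf_eq0 expr2 xx0 // => k _.
by rewrite -expr2 sqr_ge0.
Qed.

Lemma enorm0 : enorm (0 : 'cV[R]_n) = 0.
Proof. by rewrite /enorm inner0l sqrtr0. Qed.

Lemma enorm_gt0 x : x != 0 -> 0 < enorm x.
Proof. by move=> x0; rewrite lt0r enorm_ge0 (contra_neq (@enorm0_eq0 x)). Qed.

Lemma enormN x : enorm (- x) = enorm x.
Proof. by rewrite /enorm innerNl innerC innerNl opprK. Qed.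

Lemma enormB x y : enorm (x - y) = enorm (y - x).
Proof. by rewrite -opprB enormN. Qed.

Lemma sqr_enormZ t x : enorm (t *: x) ^+ 2 = t ^+ 2 * enorm x ^+ 2.
Proof. by rewrite !sqr_enorm innerZl innerZr mulrA. Qed.

Lemma sqr_enormD x y :
  enorm (x + y) ^+ 2 = enorm x ^+ 2 + 2 * inner x y + enorm y ^+ 2.
Proof.
by rewrite !sqr_enorm innerDl !innerDr (innerC y x); ring.
Qed.

Lemma sqr_enormB x y :
  enorm (x - y) ^+ 2 = enorm x ^+ 2 - 2 * inner x y + enorm y ^+ 2.
Proof.
by rewrite !sqr_enorm innerBl !innerBr (innerC y x); ring.
Qed.

Lemma sqr_enorm_comb_le t x y : 0 <= t -> t <= 1 ->
  enorm (t *: x + (1 - t) *: y) ^+ 2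
    <= t * enorm x ^+ 2 + (1 - t) * enorm y ^+ 2.
Proof.
move=> t0 t1; rewrite -subr_ge0.
have -> : t * enorm x ^+ 2 + (1 - t) * enorm y ^+ 2
    - enorm (t *: x + (1 - t) *: y) ^+ 2 = t * (1 - t) * enorm (x - y) ^+ 2.
  by rewrite sqr_enormB sqr_enormD !sqr_enormZ innerZl innerZr; ring.
by rewrite mulr_ge0 ?sqr_ge0 // mulr_ge0 // subr_ge0.
Qed.

Lemma inner_young t x y : 0 < t ->
  inner x y <= enorm x ^+ 2 / (2 * t) + t / 2 * enorm y ^+ 2.
Proof.
move=> t0; rewrite -subr_ge0.
have -> : enorm x ^+ 2 / (2 * t) + t / 2 * enorm y ^+ 2 - inner x y =
    enorm (x - t *: y) ^+ 2 / (2 * t).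
  by rewrite sqr_enormB sqr_enormZ innerZr; field; exact: lt0r_neq0.
by rewrite divr_ge0 ?sqr_ge0 // mulr_ge0 // ltW.
Qed.

Lemma cauchy_schwarz x y : inner x y <= enorm x * enorm y.
Proof.
have [->|/enorm_gt0 x0] := eqVneq x 0; first by rewrite inner0l enorm0 mul0r.
have [->|/enorm_gt0 y0] := eqVneq y 0; first by rewrite inner0r enorm0 mulr0.
have := inner_young x y (divr_gt0 x0 y0).
suff -> : enorm x ^+ 2 / (2 * (enorm x / enorm y)) +
  enorm x / enorm y / 2 * enorm y ^+ 2 = enorm x * enorm y by [].
by field; rewrite !lt0r_neq0.
Qed.

End InnerProduct.

Section ConvexCombinations.
Variables (R : numFieldType) (V : lmodType R).
Implicit Types (x y : V) (t : R).

Lemma convex_set_comb (C : set V) t x y :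
  @convex_set R V C -> 0 <= t -> t <= 1 -> C x -> C y ->
  C (t *: x + (1 - t) *: y).
Proof.
move=> C_convex t0 t1 /mem_set Cx /mem_set Cy.
by have /set_mem := C_convex x y (Itv01 t0 t1) Cx Cy.
Qed.

Lemma convex_set_segment (C : set V) t x y :
  @convex_set R V C -> 0 <= t -> t <= 1 -> C x -> C y ->
  C (t *: (y - x) + x).
Proof.
move=> C_convex t0 t1 Cx Cy; have := convex_set_comb C_convex t0 t1 Cy Cx.
by rewrite scalerBl scalerBr scale1r addrA addrAC.
Qed.

Lemma convex_functionP (f : V -> R) : @convex_function R V setT f <->
  forall t x y, 0 <= t -> t <= 1 ->
    f (t *: x + (1 - t) *: y) <= t * f x + (1 - t) * f y.
Proof.
split=> [f_convex t x y t0 t1|f_comb t x y _ _]; last exact: f_comb.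
exact: (f_convex (Itv01 t0 t1) x y (in_setT _) (in_setT _)).
Qed.

Lemma convex_function_segment (f : V -> R) t x y :
  @convex_function R V setT f -> 0 <= t -> t <= 1 ->
  f (t *: (y - x) + x) - f x <= t * (f y - f x).
Proof.
move=> /convex_functionP f_comb t0 t1; have := f_comb t y x t0 t1.
have -> : t *: y + (1 - t) *: x = t *: (y - x) + x.
  by rewrite scalerBl scalerBr scale1r addrA addrAC.
by rewrite lerBlDr mulrBl mul1r mulrBr addrA addrAC.
Qed.

Lemma convex_set_weighted_sum (C : set V) (I : Type) (r : seq I) (w : I -> R)
    (x : I -> V) :
  @convex_set R V C -> C !=set0 -> (forall i, 0 <= w i) ->
  (forall i, C (x i)) ->
  exists2 y, C y & \sum_(i <- r) w i *: x i = (\sum_(i <- r) w i) *: y.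
Proof.
move=> C_convex [a Ca] w_ge0 Cx.
elim: r => [|i r [y Cy sumE]]; first by exists a; rewrite ?big_nil ?scale0r.
have W_ge0 : 0 <= \sum_(j <- r) w j by apply: sumr_ge0.
rewrite !big_cons sumE; move: (\sum_(j <- r) w j) W_ge0 => W W_ge0.
have [wW0|wW0] := eqVneq (w i + W) 0.
  move/eqP: wW0; rewrite paddr_eq0 // => /andP[/eqP-> /eqP->].
  by exists a; rewrite ?addr0 ?scale0r ?addr0.
have wW_gt0 : 0 < w i + W by rewrite lt0r wW0 addr_ge0.
exists ((w i / (w i + W)) *: x i + (1 - w i / (w i + W)) *: y).
  apply: convex_set_comb => //; first by rewrite divr_ge0 ?addr_ge0.
  by rewrite ler_pdivrMr // mul1r lerDl.
rewrite scalerDr !scalerA mulrBr mulr1 mulrCA divff // mulr1.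
by rewrite (addrC (w i)) addrK.
Qed.

Lemma convex_set_weighted_mean (C : set V) (I : Type) (r : seq I) (w : I -> R)
    (x : I -> V) :
  @convex_set R V C -> (forall i, 0 <= w i) -> \sum_(i <- r) w i != 0 ->
  (forall i, C (x i)) ->
  C ((\sum_(i <- r) w i)^-1 *: \sum_(i <- r) w i *: x i).
Proof.
move=> C_convex w_ge0 W0 Cx.
have C_nonempty : C !=set0.
  by case: r W0 => [|i r _]; [rewrite big_nil eqxx | exists (x i)].
have [y Cy ->] := convex_set_weighted_sum r C_convex C_nonempty w_ge0 Cx.
by rewrite scalerA mulVf // scale1r.
Qed.

End ConvexCombinations.

(* The weighted means of the points [(x i, f (x i))] stay in the epigraph. *)
Lemma convex_function_weighted_mean (R : numFieldType) (V : lmodType R)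
    (f : V -> R) (I : Type) (r : seq I) (w : I -> R) (x : I -> V) :
  @convex_function R V setT f ->
  (forall i, 0 <= w i) -> 0 < \sum_(i <- r) w i ->
  (\sum_(i <- r) w i) * f ((\sum_(i <- r) w i)^-1 *: \sum_(i <- r) w i *: x i)
    <= \sum_(i <- r) w i * f (x i).
Proof.
move=> f_convex w_ge0 W_gt0.
pose epi : set (V * R^o)%type := [set p | f p.1 <= p.2].
have epi_convex : @convex_set R (V * R^o)%type epi.
  move=> p q t /set_mem /= fp /set_mem /= fq; apply/mem_set => /=.
  apply: le_trans (f_convex t p.1 q.1 (in_setT _) (in_setT _)) _.
  by apply: lerD; apply: ler_wpM2l => //; rewrite subr_ge0 le1.
have := convex_set_weighted_mean (x := fun i => (x i, f (x i))) epi_convex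
  w_ge0 (lt0r_neq0 W_gt0) (fun i => lexx _).
by rewrite /epi /= (raddf_sum fst) (raddf_sum snd) /= -ler_pdivlMl.
Qed.

Lemma set_minE (R : realType) (E : set R) (r : R) :
  E r -> lbound E r -> set_min E = r.
Proof.
move=> Er r_lb; rewrite /set_min; case: xgetP => [s _ [Es s_lb]|/(_ r)[]//].
by apply/eqP; rewrite eq_le s_lb // r_lb.
Qed.

Section CompactMinimum.
Variables (R : realType) (T : topologicalType) (K : set T) (F : T -> R).
Hypotheses (K_nonempty : K !=set0) (K_compact : compact K).
Hypothesis F_continuous : continuous F.

Lemma set_min_attained :
  exists z, [/\ K z, set_min [set F y | y in K] = F z
               & forall y, K y -> F z <= F y].
Proof.
have [z /set_mem Kz z_min] := compact_EVT_min K_nonempty K_compact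
  (continuous_subspaceT F_continuous).
have {}z_min y : K y -> F z <= F y by move=> Ky; apply/z_min/mem_set.
exists z; split=> //; apply: set_minE; first by exists z.
by move=> _ [y Ky <-]; exact: z_min.
Qed.

Lemma set_min_le z : K z -> set_min [set F y | y in K] <= F z.
Proof. by have [y [_ -> y_min]] := set_min_attained; apply: y_min. Qed.

Lemma set_min_ge c : (forall z, K z -> c <= F z) ->
  c <= set_min [set F y | y in K].
Proof. by have [y [Ky -> _]] := set_min_attained; apply. Qed.

End CompactMinimum.

(* On the compact sublevel set [f <= p - eps] of [K] the penalty [q] is bounded
   away from 0, so a large coefficient excludes that set. *)
Lemma penalty_coefficient (R : realType) (T : topologicalType) (K : set T)
    (f q : T -> R) (p eps : R) :
  compact K -> continuous f -> continuous q -> (forall z, 0 <= q z) ->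
  (forall z, K z -> q z = 0 -> p <= f z) -> 0 < eps ->
  exists2 c, 0 <= c & forall z, K z -> f z + c * q z <= p -> p - eps <= f z.
Proof.
move=> K_compact f_cont q_cont q_ge0 p_le eps_gt0.
pose low := K `&` [set z | f z <= p - eps].
have low_compact : compact low.
  apply: compact_closedI => //.
  by apply: (@closed_comp _ _ f [set x | x <= p - eps]) => //; exact: closed_le.
have [low0|low_empty] := pselect (low !=set0); last first.
  exists 0 => // z Kz _; rewrite leNgt; apply/negP => /ltW fz.
  by apply: low_empty; exists z.
have [w [[Kw fw] _ w_min]] := set_min_attained low0 low_compact q_cont.
have [v [Kv _ v_min]] := set_min_attained (ex_intro _ w Kw) K_compact f_cont.
have qw_gt0 : 0 < q w.
  rewrite lt0r q_ge0 andbT; apply/eqP => /(p_le w Kw).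
  by move: fw => /=; lra.
have c_gt0 : 0 < (p - f v + 1) / q w.
  by rewrite divr_gt0 //; have := v_min w Kw; move: fw => /=; lra.
exists ((p - f v + 1) / q w); first exact: ltW.
move=> z Kz fz_le; rewrite leNgt; apply/negP => /ltW fz.
have := ler_wpM2l (ltW c_gt0) (w_min z (conj Kz fz)).
by rewrite divfK ?lt0r_neq0 //; have := v_min z Kz; lra.
Qed.

Section DirectionalDerivatives.
Variables (R : realType) (V : normedModType R).
Implicit Types (F : V -> R) (z v : V).

Lemma derive_le_slope F z v a : derivable F z v ->
  (forall t, 0 < t -> t <= 1 -> F (t *: v + z) - F z <= t * a) ->
  'D_v F z <= a.
Proof.
move=> dF slope_le.
have quotient_cvg : h^-1 *: (F (h *: v + z) - F z) @[h --> 0^'+] --> 'D_v F z.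
  exact: cvg_dnbhs_at_right.
apply: (cvgr_to_le quotient_cvg); near=> t.
rewrite /GRing.scale /= ler_pdivrMl //; apply: slope_le => //.
by near: t; exact: nbhs_right_le.
Unshelve. all: by end_near. Qed.

Lemma is_derive_quadratic F z v a c :
  (forall t, F (t *: v + z) = F z + t * a + t ^+ 2 * c) -> is_derive z v F a.
Proof.
move=> F_line.
have quotient_cvg : h^-1 *: (F (h *: v + z) - F z) @[h --> 0^'] --> a.
  have line_cvg : (a + h * c) @[h --> 0^'] --> a.
    rewrite -[X in _ --> X]addr0 -[X in _ --> _ + X](mul0r c).
    apply: cvgD; first exact: cvg_cst.
    by apply: cvgMl; apply: cvg_within_filter; exact: cvg_id.
  apply: cvg_trans line_cvg; apply: near_eq_cvg; near=> h.
  have h0 : h != 0 by near: h; exact: nbhs_dnbhs_neq.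
  by rewrite F_line /GRing.scale /=; field.
by split; [apply/cvg_ex; exists a | exact: cvg_lim].
Unshelve. all: by end_near. Qed.

End DirectionalDerivatives.

Section EuclideanDifferentiability.
Variables (R : realType) (n : nat).
Implicit Types (z v : 'cV[R]_n).

Lemma inner_grad (F : 'cV[R]_n -> R) z v :
  differentiable F z -> inner (grad F z) v = 'D_v F z.
Proof.
move=> dF; rewrite deriveE // [in RHS](matrix_sum_delta v) linear_sum.
apply: eq_bigr => i _.
by rewrite big_ord1 mxE deriveE // linearZ /= mulrC.
Qed.

Lemma differentiable_mulmx m (A : 'M[R]_(m, n)) z :
  differentiable (fun y => A *m y) z.
Proof.
rewrite (_ : (fun y => _) = \sum_(j < n) (fun y : 'cV_n => y j 0 *: col j A)).
  apply: differentiable_sum => j; apply: differentiableZl.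
  exact: differentiable_coord.
apply/funext => y; rewrite fct_sumE; apply/matrixP => i k.
rewrite ord1 mxE summxE; apply: eq_bigr => j _.
by rewrite !mxE mulrC.
Qed.

Lemma differentiable_inner m (u w : 'cV[R]_n -> 'cV[R]_m) z :
  differentiable u z -> differentiable w z ->
  differentiable (fun y => inner (u y) (w y)) z.
Proof.
move=> du dw; rewrite /inner -fct_sumE; apply: differentiable_sum => i.
have coord (h : 'cV[R]_n -> 'cV[R]_m) :
    differentiable h z -> differentiable (fun y => h y i 0) z.
  by move=> dh; exact: (differentiable_comp dh (differentiable_coord _ i 0)).
by apply: differentiableM; exact: coord.
Qed.

End EuclideanDifferentiability.

Section FirstOrderConditions.
Variables (R : realType) (n : nat).
Implicit Types (F : 'cV[R]_n -> R) (Z : set 'cV[R]_n) (z y : 'cV[R]_n).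

Definition approx_stationary F Z (delta : R) z : Prop :=
  forall y, Z y -> - delta <= inner (grad F z) (y - z).

Lemma approx_stationary_set_min F Z delta z : Z !=set0 -> compact Z ->
  - delta <= set_min [set inner (grad F z) (y - z) | y in Z] ->
  approx_stationary F Z delta z.
Proof.
move=> Z_nonempty Z_compact delta_le y Zy; apply: le_trans delta_le _.
apply: (@set_min_le R 'cV[R]_n Z (fun y => inner (grad F z) (y - z))) => // x.
by apply: differentiable_continuous; apply: differentiable_inner.
Qed.

Lemma convex_gradient_le F z y : @convex_function R 'cV[R]_n setT F ->
  differentiable F z -> F z + inner (grad F z) (y - z) <= F y.
Proof.
move=> F_convex dF; rewrite inner_grad // -lerBrDl.
apply: derive_le_slope => [|t /ltW t0 t1]; first exact: diff_derivable.
exact: convex_function_segment.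
Qed.

Lemma minimizer_stationary F Z z : @convex_set R 'cV[R]_n Z ->
  differentiable F z -> Z z -> (forall y, Z y -> F z <= F y) ->
  approx_stationary F Z 0 z.
Proof.
move=> Z_convex dF Zz z_min y Zy.
have dFv : derivable F z (y - z) by exact: diff_derivable.
rewrite inner_grad // oppr0 -oppr_le0 -deriveN //.
apply: derive_le_slope => [|t /ltW t0 t1]; first exact: derivableN.
rewrite mulr0 /= opprK addrC subr_le0; apply: z_min.
exact: convex_set_segment.
Qed.

End FirstOrderConditions.

Section ThetaSequence.
Variable R : realType.

Lemma theta_sumS k : theta_sum R k.+1 = theta_sum R k + theta R k.+1.
Proof. by rewrite /theta_sum big_ord_recr. Qed.

Lemma theta_ge k : (k%:R + 2) / 2 <= theta R k.
Proof.
elim: k => [|k IHk]; first by rewrite /=; lra.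
have t0 : 0 <= theta R k by have := ler0n R k; lra.
rewrite -natr1 /= ler_pM2r ?invr_gt0 //.
suff : 2 * theta R k <= Num.sqrt (4 * theta R k ^+ 2 + 1) by lra.
by rewrite -(ger0_norm (mulr_ge0 _ t0)) // -sqrtr_sqr ler_sqrt ?exprMn; nra.
Qed.

Lemma theta_gt0 k : 0 < theta R k.
Proof. by have := theta_ge k; have := ler0n R k; lra. Qed.

Lemma theta_sqr k : theta R k ^+ 2 = theta_sum R k.
Proof.
elim: k => [|k IHk]; first by rewrite /theta_sum big_ord1 expr1n.
rewrite theta_sumS -IHk /=; set s := Num.sqrt _.
have : s ^+ 2 = 4 * theta R k ^+ 2 + 1.
  by rewrite sqr_sqrtr // addr_ge0 // mulr_ge0 // sqr_ge0.
by nra.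
Qed.

Lemma theta_sum_gt0 k : 0 < theta_sum R k.
Proof. by rewrite -theta_sqr exprn_gt0 // theta_gt0. Qed.

Lemma sum_theta_sum_le k :
  \sum_(j < k.+1) theta_sum R j <= (k%:R + 1) * theta_sum R k.
Proof.
elim: k => [|k IHk]; first by rewrite big_ord1 add0r mul1r.
rewrite big_ord_recr /= -natr1 theta_sumS.
by have := theta_gt0 k.+1; have := ler0n R k; nra.
Qed.

Lemma sqr_le_theta_sum_floor (r : R) k : 0 <= r -> k%:Z = Num.floor (2 * r) ->
  r ^+ 2 <= theta_sum R k.
Proof.
move=> r0 kE; have /andP[_] := floor_itv (2 * r).
rewrite -kE intrD1 -pmulrn -theta_sqr => r_lt.
by have := theta_ge k; nra.
Qed.

Lemma theta_sum_iteration_count (D L eps : R) k :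
  0 <= D -> 0 < L -> 0 < eps ->
  k%:Z = Num.floor (2 * D * Num.sqrt (L / eps)) ->
  L * D ^+ 2 <= theta_sum R k * eps.
Proof.
move=> D0 L0 eps0; rewrite -mulrA => kE.
have := sqr_le_theta_sum_floor (mulr_ge0 D0 (sqrtr_ge0 _)) kE.
rewrite exprMn sqr_sqrtr; last by rewrite divr_ge0 // ltW.
by rewrite mulrA ler_pdivrMr // [D ^+ 2 * L]mulrC.
Qed.

End ThetaSequence.

Local Arguments theta : simpl never.

(* The oracle of a concave function [d] with [1 / eta]-Lipschitz gradient,
   queried at [x]: [c] is the intercept of the affine majorant of [d], not its
   value at [x]. *)
Definition inexact_oracle (R : realType) (m : nat) (d : 'cV[R]_m -> R)
    (eta delta : R) (x : 'cV[R]_m) (c : R) (g : 'cV[R]_m) : Prop :=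
  forall y, c + inner y g - delta - enorm (y - x) ^+ 2 / (2 * eta) <= d y
            <= c + inner y g.

Section FastGradient.
Variables (R : realType) (m : nat) (d : 'cV[R]_m -> R) (eta delta : R).
Variables (c : nat -> R) (g lam mu : nat -> 'cV[R]_m).

Definition dual_averaging_point k : 'cV[R]_m :=
  lam 0%N + eta *: \sum_(i < k.+1) theta R i *: g i.

Definition weighted_model k x : R :=
  \sum_(j < k.+1) theta R j * (c j + inner x (g j)).

Definition estimate_function k x : R :=
  weighted_model k x - enorm (x - lam 0%N) ^+ 2 / (2 * eta).

Hypothesis eta_gt0 : 0 < eta.
Hypothesis oracle : forall k, inexact_oracle d eta delta (lam k) (c k) (g k).
Hypothesis mu_step : forall k, mu k = lam k + eta *: g k.
Hypothesis lam_step : forall k,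
  let a := (theta_sum R k.+1)^-1 * theta R k.+1 in
  lam k.+1 = (1 - a) *: mu k + a *: dual_averaging_point k.

Let eta0 : eta != 0 := lt0r_neq0 eta_gt0.

Lemma gradient_step_ge k :
  c k + inner (lam k) (g k) + eta / 2 * enorm (g k) ^+ 2 - delta <= d (mu k).
Proof.
have /andP[+ _] := oracle k (mu k).
rewrite mu_step (addrC (lam k)) addrK innerDl innerZl -sqr_enorm sqr_enormZ.
suff -> : eta ^+ 2 * enorm (g k) ^+ 2 / (2 * eta) =
  eta / 2 * enorm (g k) ^+ 2 by lra.
by field.
Qed.

Lemma theta_sum_lamS k : theta_sum R k.+1 *: lam k.+1 =
  theta_sum R k *: mu k + theta R k.+1 *: dual_averaging_point k.
Proof.
have S0 := lt0r_neq0 (theta_sum_gt0 R k.+1).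
rewrite lam_step scalerDr !scalerA mulrBr mulr1 mulrA divff // mul1r.
by rewrite [in X in X - _]theta_sumS addrK.
Qed.

Lemma estimate_function_center k x :
  let v := dual_averaging_point k in
  estimate_function k x =
    estimate_function k v - enorm (x - v) ^+ 2 / (2 * eta).
Proof.
move=> v; rewrite /estimate_function; set s := \sum_(i < k.+1) theta R i *: g i.
have -> : weighted_model k x = weighted_model k v + inner (x - v) s.
  rewrite inner_sumr -big_split; apply: eq_bigr => j _ /=.
  by rewrite innerZr innerBl; ring.
have vE : v - lam 0%N = eta *: s by rewrite addrC addKr.
have -> : x - lam 0%N = (x - v) + eta *: s by rewrite -vE addrA subrK.
by rewrite vE sqr_enormD sqr_enormZ innerZr; field.
Qed.

Lemma estimate_function_le k x :
  estimate_function k x <=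
  theta_sum R k * d (mu k) + (\sum_(j < k.+1) theta_sum R j) * delta.
Proof.
elim: k x => [|k IHk] x.
  have := inner_young (x - lam 0%N) (g 0%N) eta_gt0; have := gradient_step_ge 0.
  rewrite /estimate_function /weighted_model /theta_sum !big_ord1 innerBl.
  by rewrite [theta R 0]/theta; lra.
set v := dual_averaging_point k.
have -> : estimate_function k.+1 x = estimate_function k v
    + theta R k.+1 * (c k.+1 + inner x (g k.+1))
    - enorm (x - v) ^+ 2 / (2 * eta).
  rewrite addrAC -estimate_function_center.
  by rewrite /estimate_function /weighted_model big_ord_recr addrAC.
rewrite [in leRHS]big_ord_recr /=.
have /andP[_ d_mu_le] := oracle k.+1 (mu k).
have := ler_wpM2l (ltW (theta_sum_gt0 R k)) d_mu_le.
have := ler_wpM2l (ltW (theta_sum_gt0 R k.+1)) (gradient_step_ge k.+1).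
have : theta_sum R k.+1 * inner (lam k.+1) (g k.+1) =
    theta_sum R k * inner (mu k) (g k.+1) + theta R k.+1 * inner v (g k.+1).
  by rewrite -!innerZl -innerDl -theta_sum_lamS.
(* As [theta_k.+1 ^ 2 = S_k.+1], the Young term below is the gain of the
   gradient step from [lam k.+1] to [mu k.+1]. *)
have := inner_young (x - v) (theta R k.+1 *: g k.+1) eta_gt0.
rewrite innerZr innerBl sqr_enormZ theta_sqr theta_sumS.
by have := IHk v; lra.
Qed.

Lemma fast_gradient_model_le k x : 0 <= delta ->
  weighted_model k x <= theta_sum R k * (d (mu k) + (k%:R + 1) * delta)
    + enorm (x - lam 0%N) ^+ 2 / (2 * eta).
Proof.
move=> delta0; have := ler_wpM2r delta0 (sum_theta_sum_le R k).
have := estimate_function_le k x.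
by rewrite /estimate_function; lra.
Qed.

End FastGradient.

Section AugmentedLagrangian.
Variables (R : realType) (m n : nat).
Variables (f : 'cV[R]_n -> R) (A : 'M[R]_(m, n)) (b : 'cV[R]_m).
Variable Z : set 'cV[R]_n.
Hypotheses (f_convex : @convex_function R 'cV[R]_n setT f)
  (f_diff : forall z, differentiable f z).

Implicit Types (z y v : 'cV[R]_n) (l x : 'cV[R]_m) (rho delta : R).

Local Notation residual z := (A *m z - b).
Local Notation aug rho l := (fun z => aug_lagrangian f A b rho z l).

Lemma residual_line t v z :
  residual (t *: v + z) = t *: (A *m v) + residual z.
Proof. by rewrite mulmxDr -scalemxAr addrA. Qed.

Lemma residual_comb t z y :
  residual (t *: z + (1 - t) *: y) = t *: residual z + (1 - t) *: residual y.
Proof.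
rewrite mulmxDr -!scalemxAr !scalerBr [in RHS]addrACA -opprD -scalerDl.
by rewrite [t + _]addrC subrK scale1r.
Qed.

Lemma mulmx_residual z y : A *m (y - z) = residual y - residual z.
Proof. by rewrite mulmxBr opprB addrA subrK. Qed.

Lemma sqr_residual_eq0 z : enorm (residual z) ^+ 2 = 0 <-> A *m z = b.
Proof.
split=> [/eqP|->]; last by rewrite subrr enorm0 expr0n.
by rewrite sqrf_eq0 => /eqP/enorm0_eq0/subr0_eq.
Qed.

Lemma differentiable_residual z : differentiable (fun y => residual y) z.
Proof. by apply: differentiableB => //; exact: differentiable_mulmx. Qed.

Lemma continuous_sqr_residual : continuous (fun z => enorm (residual z) ^+ 2).
Proof.
move=> z; apply: differentiable_continuous.
under eq_fun do rewrite sqr_enorm.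
by apply: differentiable_inner; exact: differentiable_residual.
Qed.

Lemma differentiable_aug_lagrangian rho l z : differentiable (aug rho l) z.
Proof.
rewrite /aug_lagrangian; under eq_fun do rewrite sqr_enorm.
apply: differentiableD; first apply: differentiableD => //.
  by apply: differentiable_inner => //; exact: differentiable_residual.
apply: (@differentiableZ _ _ _ (fun y => inner (residual y) (residual y))).
by apply: differentiable_inner; exact: differentiable_residual.
Qed.

Lemma continuous_aug_lagrangian rho l : continuous (aug rho l).
Proof.
by move=> z; apply/differentiable_continuous/differentiable_aug_lagrangian.
Qed.

Lemma inner_grad_aug_lagrangian rho l z v :
  inner (grad_aug_lagrangian f A b rho z l) v =
  inner (grad f z) v + inner (l + rho *: residual z) (A *m v).
Proof.
rewrite !inner_grad //; last exact: differentiable_aug_lagrangian.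
have df : is_derive z v f ('D_v f z) by apply/derivableP/diff_derivable.
have dpen : is_derive z v
    (fun y => inner l (residual y) + rho / 2 * enorm (residual y) ^+ 2)
    (inner (l + rho *: residual z) (A *m v)).
  apply: (is_derive_quadratic (c := rho / 2 * enorm (A *m v) ^+ 2)) => t.
  rewrite residual_line sqr_enormD sqr_enormZ innerDr innerDl !innerZr !innerZl.
  by rewrite (innerC (A *m v)); field.
have /= <- := @derive_val _ _ _ _ _ _ _ (is_deriveD df dpen).
by congr ('D_v _ z); apply/funext => y; rewrite /aug_lagrangian -addrA.
Qed.

Lemma convex_aug_lagrangian rho l : 0 <= rho ->
  @convex_function R 'cV[R]_n setT (aug rho l).
Proof.
move=> rho0; apply/convex_functionP => t z y t0 t1.
have /convex_functionP/(_ t z y t0 t1) f_le := f_convex.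
have half_rho0 : 0 <= rho / 2 by rewrite divr_ge0.
have := ler_wpM2l half_rho0 (sqr_enorm_comb_le (residual z) (residual y) t0 t1).
by rewrite /aug_lagrangian residual_comb innerDr !innerZr; lra.
Qed.

Lemma aug_stationary_lagrangian_le rho l z delta y :
  approx_stationary (aug rho l) Z delta z -> Z y ->
  f z + inner (l + rho *: residual z) (residual z) - delta
    <= f y + inner (l + rho *: residual z) (residual y).
Proof.
move=> z_stat Zy; have := z_stat y Zy.
rewrite inner_grad_aug_lagrangian mulmx_residual [inner (l + _) _]innerBr.
by have := convex_gradient_le y f_convex (f_diff z); lra.
Qed.

Hypotheses (Z_nonempty : Z !=set0) (Z_compact : compact Z)
  (Z_convex : @convex_set R 'cV[R]_n Z).

Lemma aug_dual_le rho l z : Z z ->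
  aug_dual f A b Z rho l <= aug_lagrangian f A b rho z l.
Proof. by apply: set_min_le => //; exact: continuous_aug_lagrangian. Qed.

Lemma aug_dual_ge rho l a :
  (forall z, Z z -> a <= aug_lagrangian f A b rho z l) ->
  a <= aug_dual f A b Z rho l.
Proof. by apply: set_min_ge => //; exact: continuous_aug_lagrangian. Qed.

Lemma aug_dual_oracle rho l z delta : 0 < rho -> Z z ->
  approx_stationary (aug rho l) Z delta z ->
  inexact_oracle (aug_dual f A b Z rho) rho delta l
    (f z + rho / 2 * enorm (residual z) ^+ 2) (residual z).
Proof.
move=> rho0 Zz z_stat x; apply/andP; split; last first.
  by apply: le_trans (aug_dual_le rho x Zz) _; rewrite /aug_lagrangian addrAC.
apply: aug_dual_ge => y Zy; rewrite /aug_lagrangian.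
have := aug_stationary_lagrangian_le z_stat Zy.
have := inner_young (l - x) (residual y - residual z) rho0.
move: (residual z) (residual y) => r w; rewrite (enormB l) (sqr_enormB w).
by rewrite !innerBr !innerBl !innerDl !innerZl -!sqr_enorm (innerC r w); lra.
Qed.

Lemma aug_lagrangian0 z l :
  aug_lagrangian f A b 0 z l = f z + inner l (residual z).
Proof. by rewrite /aug_lagrangian !mul0r addr0. Qed.

Lemma lagrange_dualE l : lagrange_dual f A b Z l = aug_dual f A b Z 0 l.
Proof. by rewrite /aug_dual; under eq_imagel do rewrite aug_lagrangian0. Qed.

Lemma lagrange_dual_le l z : Z z ->
  lagrange_dual f A b Z l <= f z + inner l (residual z).
Proof. by move=> Zz; rewrite lagrange_dualE -aug_lagrangian0 aug_dual_le. Qed.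

Lemma penalty_minimizer_le_lagrange_dual c : exists z,
  [/\ Z z, f z + c * enorm (residual z) ^+ 2
             <= lagrange_dual f A b Z (c *: residual z)
    & forall y, Z y ->
        aug_lagrangian f A b c z 0 <= aug_lagrangian f A b c y 0].
Proof.
have [z [Zz _ z_min]] :=
  set_min_attained Z_nonempty Z_compact (@continuous_aug_lagrangian c 0).
exists z; split=> //; rewrite lagrange_dualE; apply: aug_dual_ge => y Zy.
have z_stat : approx_stationary (aug c 0) Z 0 z.
  by apply: minimizer_stationary => //; exact: differentiable_aug_lagrangian.
have := aug_stationary_lagrangian_le z_stat Zy.
by rewrite aug_lagrangian0 add0r subr0 innerZl -sqr_enorm.
Qed.

Hypothesis feasible_nonempty : feasible A b Z !=set0.

Lemma primal_value_attained :
  exists z, [/\ feasible A b Z z, primal_value f A b Z = f z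
               & forall y, feasible A b Z y -> f z <= f y].
Proof.
apply: set_min_attained => //; last first.
  by move=> z; exact: differentiable_continuous.
rewrite (_ : feasible A b Z = Z `&` [set z | enorm (residual z) ^+ 2 = 0]).
  apply: compact_closedI => //.
  apply: (@closed_comp _ _ (fun z => enorm (residual z) ^+ 2) [set 0]).
    by move=> z _; exact: continuous_sqr_residual.
  exact: closed_eq.
by apply/seteqP; split=> z /= [] => [/sqr_residual_eq0|?/sqr_residual_eq0].
Qed.

Lemma aug_dual_le_primal_value rho l :
  aug_dual f A b Z rho l <= primal_value f A b Z.
Proof.
have [z [[Az Zz] -> _]] := primal_value_attained.
apply: le_trans (aug_dual_le rho l Zz) _.
by rewrite /aug_lagrangian Az subrr inner0r enorm0 expr0n mulr0 !addr0.
Qed.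

Lemma lagrange_dual_near_primal_value eps : 0 < eps ->
  exists l, primal_value f A b Z - eps <= lagrange_dual f A b Z l.
Proof.
move=> eps0; have [w [[Aw Zw] -> w_min]] := primal_value_attained.
have f_ge z : Z z -> enorm (residual z) ^+ 2 = 0 -> f w <= f z.
  by move=> Zz /sqr_residual_eq0 Az; exact: w_min.
have f_cont : continuous f by move=> z; exact: differentiable_continuous.
have [c c0 penalty] := penalty_coefficient Z_compact f_cont
  continuous_sqr_residual (fun z => sqr_ge0 _) f_ge eps0.
have [z [Zz z_dual z_min]] :=
  penalty_minimizer_le_lagrange_dual (2 * c).
exists ((2 * c) *: residual z); apply: le_trans z_dual.
apply: le_trans (penalty z Zz _) _; last first.
  by rewrite lerDl mulr_ge0 ?sqr_ge0 // mulr_ge0.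
have := z_min w Zw; rewrite /aug_lagrangian !inner0l Aw subrr enorm0 expr0n.
by rewrite /=; lra.
Qed.

Lemma strong_duality l :
  (forall l', lagrange_dual f A b Z l' <= lagrange_dual f A b Z l) ->
  lagrange_dual f A b Z l = primal_value f A b Z.
Proof.
move=> l_max; apply/eqP; rewrite eq_le; apply/andP; split.
  by rewrite lagrange_dualE aug_dual_le_primal_value.
apply/ler_addgt0Pr => eps /lagrange_dual_near_primal_value[l' l'_ge].
by have := l_max l'; lra.
Qed.

End AugmentedLagrangian.

Section PrimalRecovery.
Variables (R : realType) (m : nat) (lambda0 lambda_star r : 'cV[R]_m).
Variables (fstar fz dual sigma err eps : R).
Local Notation Rd := (enorm (lambda0 - lambda_star)).
Hypotheses (sigma_gt0 : 0 < sigma) (eps_gt0 : 0 < eps) (Rd_gt0 : 0 < Rd).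
Hypothesis certificate : forall x,
  fz + inner x r <= dual + enorm (x - lambda0) ^+ 2 / (2 * sigma) + err.
Hypotheses (weak_duality : dual <= fstar)
  (saddle : fstar <= fz + inner lambda_star r).
Hypotheses (Rd_sqr_le : Rd ^+ 2 <= sigma * eps) (err_le : err <= 3 / 8 * eps).

Lemma dual_gap_le : fstar - dual <= eps.
Proof.
have Rd_le : Rd ^+ 2 / (2 * sigma) <= eps / 2.
  by rewrite ler_pdivrMr ?mulr_gt0 //; have := Rd_sqr_le; lra.
have := certificate lambda_star; rewrite (enormB lambda_star).
by have := saddle; have := err_le; have := eps_gt0; lra.
Qed.

Lemma sqr_residual_norm_le :
  sigma / 2 * enorm r ^+ 2 <= Rd * enorm r + err.
Proof.
have := certificate (lambda0 + sigma *: r).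
rewrite (addrC lambda0) addrK sqr_enormZ innerDl innerZl -sqr_enorm.
have -> : sigma ^+ 2 * enorm r ^+ 2 / (2 * sigma) = sigma / 2 * enorm r ^+ 2.
  by field; exact: lt0r_neq0.
have := cauchy_schwarz (lambda_star - lambda0) r.
rewrite innerBl (enormB lambda_star).
by have := saddle; have := weak_duality; lra.
Qed.

Lemma residual_norm_le : enorm r <= 3 / Rd * eps.
Proof.
have r0 := enorm_ge0 r.
have Rdr_sqr_le :
    (Rd * enorm r) ^+ 2 <= 2 * eps * (Rd * enorm r) + 3 / 4 * eps ^+ 2.
  have := ler_wpM2r (sqr_ge0 (enorm r)) Rd_sqr_le.
  have := ler_wpM2l (ltW eps_gt0) sqr_residual_norm_le.
  by have := ler_wpM2l (ltW eps_gt0) err_le; rewrite exprMn; lra.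
rewrite mulrAC ler_pdivlMr // mulrC leNgt; apply/negP => Rdr_gt.
by have := eps_gt0; nra.
Qed.

Lemma primal_gap_ge : - (3 * enorm lambda_star / Rd * eps) <= fz - fstar.
Proof.
have := ler_wpM2l (enorm_ge0 lambda_star) residual_norm_le.
have := cauchy_schwarz lambda_star r; have := saddle.
by rewrite [3 * _]mulrC -!mulrA; lra.
Qed.

Lemma primal_gap_le :
  fz - fstar <= (enorm lambda0 ^+ 2 + Rd ^+ 2) / (2 * Rd ^+ 2) * eps.
Proof.
have := certificate 0; rewrite inner0l addr0 sub0r enormN.
have lambda0_le : enorm lambda0 ^+ 2 / (2 * sigma) <=
    enorm lambda0 ^+ 2 / (2 * Rd ^+ 2) * eps.
  rewrite -mulrA ler_wpM2l ?sqr_ge0 //.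
  rewrite [leRHS]mulrC ler_pdivlMr ?mulr_gt0 ?exprn_gt0 //.
  by rewrite mulrC ler_pdivrMr ?mulr_gt0 //; have := Rd_sqr_le; lra.
have -> : (enorm lambda0 ^+ 2 + Rd ^+ 2) / (2 * Rd ^+ 2) * eps =
    enorm lambda0 ^+ 2 / (2 * Rd ^+ 2) * eps + eps / 2.
  by field; exact: lt0r_neq0.
by have := weak_duality; have := err_le; have := eps_gt0; lra.
Qed.

End PrimalRecovery.

Section DualFastGradient.
Variables (R : realType) (m n : nat).
Variables (f : 'cV[R]_n -> R) (A : 'M[R]_(m, n)) (b : 'cV[R]_m).
Variable Z : set 'cV[R]_n.
Hypotheses (f_convex : @convex_function R 'cV[R]_n setT f)
  (f_diff : forall z, differentiable f z).
Hypotheses (Z_nonempty : Z !=set0) (Z_compact : compact Z)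
  (Z_convex : @convex_set R 'cV[R]_n Z).
Variables (rho delta : R) (zbar : 'cV[R]_m -> 'cV[R]_n).
Hypotheses (rho_gt0 : 0 < rho) (delta_ge0 : 0 <= delta).
Hypothesis zbar_in : forall l, Z (zbar l).
Hypothesis zbar_stationary : forall l,
  approx_stationary (fun z => aug_lagrangian f A b rho z l) Z delta (zbar l).
Variables lam mu : nat -> 'cV[R]_m.

Let g k : 'cV[R]_m := A *m zbar (lam k) - b.

Hypothesis mu_step : forall k, mu k = lam k + rho *: g k.
Hypothesis lam_step : forall k,
  let a := (theta_sum R k.+1)^-1 * theta R k.+1 in
  lam k.+1 = (1 - a) *: mu k + a *: dual_averaging_point rho g lam k.

Definition primal_average k : 'cV[R]_n :=
  (theta_sum R k)^-1 *: \sum_(j < k.+1) theta R j *: zbar (lam j).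

Lemma primal_average_in k : Z (primal_average k).
Proof.
apply: convex_set_weighted_mean => // [i|]; first exact/ltW/theta_gt0.
exact/lt0r_neq0/theta_sum_gt0.
Qed.

(* The affine majorant returned by the oracle is [x |-> L_rho (zbar_j, x)], so
   Jensen's inequality turns the weighted model into [L_rho] at the average. *)
Lemma aug_lagrangian_primal_average_le k x :
  aug_lagrangian f A b rho (primal_average k) x
  <= aug_dual f A b Z rho (mu k)
     + enorm (x - lam 0%N) ^+ 2 / (2 * (rho * theta_sum R k))
     + (k%:R + 1) * delta.
Proof.
pose c j := f (zbar (lam j)) + rho / 2 * enorm (g j) ^+ 2.
have oracle j :
    inexact_oracle (aug_dual f A b Z rho) rho delta (lam j) (c j) (g j).
  exact: aug_dual_oracle.
have S_gt0 := theta_sum_gt0 R k.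
have := fast_gradient_model_le rho_gt0 oracle mu_step lam_step k x delta_ge0.
have -> : weighted_model c g k x =
    \sum_(j < k.+1) theta R j * aug_lagrangian f A b rho (zbar (lam j)) x.
  by apply: eq_bigr => j _; rewrite /aug_lagrangian addrAC.
have average_le : theta_sum R k * aug_lagrangian f A b rho (primal_average k) x
    <= \sum_(j < k.+1) theta R j * aug_lagrangian f A b rho (zbar (lam j)) x.
  apply: (convex_function_weighted_mean _
    (convex_aug_lagrangian A b f_convex x (ltW rho_gt0))) => // j.
  exact/ltW/theta_gt0.
move=> /(le_trans average_le); rewrite -ler_pdivlMl // => /le_trans; apply.
by rewrite le_eqVlt; apply/orP; left; apply/eqP; field; rewrite !lt0r_neq0.
Qed.

Lemma lagrangian_primal_average_le k x :
  f (primal_average k) + inner x (A *m primal_average k - b)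
  <= aug_dual f A b Z rho (mu k)
     + enorm (x - lam 0%N) ^+ 2 / (2 * (rho * theta_sum R k))
     + (k%:R + 1) * delta.
Proof.
apply: le_trans (aug_lagrangian_primal_average_le k x).
by rewrite lerDl mulr_ge0 ?sqr_ge0 // divr_ge0 // ltW.
Qed.

Hypothesis feasible_nonempty : feasible A b Z !=set0.
Variable lambda_star : 'cV[R]_m.
Hypothesis lambda_star_max : forall l,
  lagrange_dual f A b Z l <= lagrange_dual f A b Z lambda_star.

Local Notation fstar := (primal_value f A b Z).
Local Notation Rd := (enorm (lam 0%N - lambda_star)).

Lemma primal_value_le_lagrangian z : Z z ->
  fstar <= f z + inner lambda_star (A *m z - b).
Proof.
rewrite -(strong_duality f_convex f_diff Z_nonempty Z_compact Z_convex
  feasible_nonempty lambda_star_max).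
exact: lagrange_dual_le.
Qed.

Theorem dual_fast_gradient_accuracy k eps :
  0 < eps -> 0 < Rd -> Rd ^+ 2 <= rho * theta_sum R k * eps ->
  (k%:R + 1) * delta <= 3 / 8 * eps ->
  [/\ fstar - aug_dual f A b Z rho (mu k) <= eps,
      enorm (A *m primal_average k - b) <= 3 / Rd * eps,
      - (3 * enorm lambda_star / Rd * eps) <= f (primal_average k) - fstar
    & f (primal_average k) - fstar
        <= (enorm (lam 0%N) ^+ 2 + Rd ^+ 2) / (2 * Rd ^+ 2) * eps].
Proof.
move=> eps_gt0 Rd_gt0 Rd_sqr_le err_le.
have sigma_gt0 := mulr_gt0 rho_gt0 (theta_sum_gt0 R k).
have weak_duality := aug_dual_le_primal_value f_diff Z_nonempty Z_compact
  feasible_nonempty rho (mu k).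
have saddle := primal_value_le_lagrangian (primal_average_in k).
have certificate := lagrangian_primal_average_le k.
split.
- exact: dual_gap_le certificate saddle Rd_sqr_le err_le.
- exact: residual_norm_le certificate weak_duality saddle Rd_sqr_le err_le.
- exact: primal_gap_ge certificate weak_duality saddle Rd_sqr_le err_le.
- exact: primal_gap_le certificate weak_duality Rd_sqr_le err_le.
Qed.

End DualFastGradient.

Lemma diam_ge0 (R : realType) (n : nat) (Z : set 'cV[R]_n) : 0 <= diam Z.
Proof.
rewrite /diam /set_max; case: xgetP => [r _ [[p _ <-] _]|] //.
exact: enorm_ge0.
Qed.

Lemma inexactness_budget (R : realFieldType) (c eps_in eps_out : R) (k : nat) :
  0 < c -> 0 < eps_out -> eps_in = 3 / (8 * c * (k%:R + 3)) * eps_out ->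
  0 <= c * eps_in /\ (k%:R + 1) * (c * eps_in) <= 3 / 8 * eps_out.
Proof.
move=> c_gt0 eps_gt0 ->; have k3_gt0 : 0 < k%:R + 3 :> R by rewrite ltr_wpDl.
have -> : c * (3 / (8 * c * (k%:R + 3)) * eps_out) =
    3 / 8 * eps_out / (k%:R + 3) by field; rewrite !lt0r_neq0.
split; first by rewrite divr_ge0 ?ltW // mulr_gt0.
by rewrite mulrA ler_pdivrMr //; lra.
Qed.

Theorem mainTheorem8 (R : realType) (m n : nat)
    (f : 'cV[R]_n -> R) (A : 'M[R]_(m, n)) (b : 'cV[R]_m)
    (Z : set 'cV[R]_n) (rho Lp : R)
    (f_convex : @convex_function R 'cV[R]_n setT f)
    (f_diff : forall z, differentiable f z)
    (A_rank : row_free A)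
    (Z_nonempty : Z !=set0) (Z_compact : compact Z)
    (Z_convex : @convex_set R 'cV[R]_n Z)
    (rho_gt0 : 0 < rho)
    (Lp_gt0 : 0 < Lp)
    (grad_lipschitz : forall lambda z y,
      enorm (grad_aug_lagrangian f A b rho z lambda
             - grad_aug_lagrangian f A b rho y lambda) <= Lp * enorm (z - y))
    (slater_cq : slater A b Z)
    (fstar Rp Ld : R)
    (fstarE : fstar = primal_value f A b Z)
    (RpE : Rp = diam Z)
    (LdE : Ld = 1 / rho)
    (lambda_star : 'cV[R]_m)
    (lambda_star_max :
      forall lambda, lagrange_dual f A b Z lambda <= lagrange_dual f A b Z lambda_star)
    (zbar : 'cV[R]_m -> 'cV[R]_n)
    (zbar_in : forall lambda, Z (zbar lambda))
    (eps_out Rd eps_in : R) (lambda0 : 'cV[R]_m) (k_out : nat)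
    (eps_out_gt0 : 0 < eps_out)
    (RdE : Rd = enorm (lambda0 - lambda_star))
    (Rd_gt0 : 0 < Rd)
    (k_outE : k_out%:Z = Num.floor (2 * Rd * Num.sqrt (Ld / eps_out)))
    (eps_inE : eps_in =
      3 / (8 * (1 + Num.sqrt (2 * Lp) * Rp) * (k_out%:R + 3)) * eps_out)
    (zbar_approx : forall lambda,
      set_min [set inner (grad_aug_lagrangian f A b rho (zbar lambda) lambda)
                         (z - zbar lambda) | z in Z]
        >= - ((1 + Num.sqrt (2 * Lp) * Rp) * eps_in))
    (lambda_ mu_ : nat -> 'cV[R]_m)
    (lambda_0 : lambda_ 0%N = lambda0)
    (mu_step : forall k,
      mu_ k = lambda_ k + Ld^-1 *: (A *m zbar (lambda_ k) - b))
    (lambda_step : forall k,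
      let a := (theta_sum R k.+1)^-1 * theta R k.+1 in
      lambda_ k.+1 = (1 - a) *: mu_ k
        + a *: (lambda0 + Ld^-1 *:
            \sum_(i < k.+1) theta R i *: (A *m zbar (lambda_ i) - b)))
    (zhat : nat -> 'cV[R]_n)
    (zhatE : forall k, zhat k =
      (theta_sum R k)^-1 *: \sum_(j < k.+1) theta R j *: zbar (lambda_ j)) :
  [/\ fstar - aug_dual f A b Z rho (mu_ k_out) <= eps_out,
      Z (zhat k_out),
      enorm (A *m zhat k_out - b) <= 3 / Rd * eps_out,
      - ((3 * enorm lambda_star / Rd + 9 * rho / (2 * Rd ^+ 2) * eps_out)
           * eps_out)
        <= f (zhat k_out) - fstar
    & f (zhat k_out) - fstar
        <= (enorm lambda0 ^+ 2 + Rd ^+ 2) / (2 * Rd ^+ 2) * eps_out].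
Proof.
have feasible_nonempty : feasible A b Z !=set0.
  by have [z [Zz _] Az] := slater_cq; exists z.
have accuracy_factor_gt0 : 0 < 1 + Num.sqrt (2 * Lp) * Rp.
  by rewrite ltr_wpDr // RpE mulr_ge0 ?sqrtr_ge0 ?diam_ge0.
have [delta_ge0 err_le] :=
  inexactness_budget accuracy_factor_gt0 eps_out_gt0 eps_inE.
have zbar_stat l :=
  approx_stationary_set_min Z_nonempty Z_compact (zbar_approx l).
have Rd_sqr_le : Rd ^+ 2 <= rho * theta_sum R k_out * eps_out.
  have Ld_gt0 : 0 < Ld by rewrite LdE divr_gt0.
  have := theta_sum_iteration_count (ltW Rd_gt0) Ld_gt0 eps_out_gt0 k_outE.
  by rewrite LdE div1r ler_pdivrMl // mulrA.
rewrite LdE div1r invrK in mu_step lambda_step; subst lambda0 Rd fstar.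
have [gap residual f_ge f_le] := dual_fast_gradient_accuracy f_convex f_diff
  Z_nonempty Z_compact Z_convex rho_gt0 delta_ge0 zbar_in zbar_stat mu_step
  lambda_step feasible_nonempty lambda_star_max eps_out_gt0 Rd_gt0 Rd_sqr_le
  err_le.
have zhat_in := primal_average_in Z_convex zbar_in lambda_ k_out.
rewrite /primal_average -zhatE in residual f_ge f_le zhat_in.
split=> //; apply: le_trans f_ge; rewrite lerN2 [leRHS]mulrDl lerDl.
by rewrite !mulr_ge0 ?invr_ge0 ?mulr_ge0 ?sqr_ge0 // ltW.
Qed.
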